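(* Let $a,c$ be nonzero complex numbers and let $\ell,m,n$ be nonnegative integers with $m\le n$. Then $$ {}_4\phi_3\left[\begin{matrix}q^{\ell}a,\,c,\,q^{-n},\,-q^{m-n}\\ \sqrt{qac},\,-q^{\ell}\sqrt{qac},\,q^{m-2n}\end{matrix};q,q\right] =\frac{(q^{\ell}a,\,\sqrt{qa/c};q)_\ell}{(q^{\ell}a/c,\,\sqrt{qac};q)_\ell}\sum_{i=0}^{\ell}\sum_{j=0}^{m}T_{i,j}, $$ where $$ T_{i,j}=q^{\frac{5i}{2}+(m-n)j+\binom{j+1}{2}}\,\frac{1}{(ac)^{i/2}}\,\frac{1-q^{2\ell-2i}a/c}{1-q^{2\ell}a/c}\, \frac{(q^{-\ell},\,c,\,q^{-2\ell}c/a;q)_i}{(q,\,q^{1-2\ell}/a,\,q^{1-\ell}c/a;q)_i} $$ $$ \times\frac{(q^{-m},q^{-n},-q^{-n},q^{2\ell-i}a,q^{i}c;q)_j}{(q,\,q^{\ell}\sqrt{qac},\,-q^{\ell}\sqrt{qac},\,q^{m-2n},\,q^{j-2n-1};q)_j}\, \frac{(q^{1+2\ell-i+j}a,\,q^{1+i+j}c;q^2)_{n-j}}{(q,\,q^{1+2\ell+2j}ac;q^2)_{n-j}}. $$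
   Context: $q$ is a nonzero complex number. For complex $x$ and an integer $n\ge 0$, the $q$-shifted factorial is $(x;q)_0=1$, $(x;q)_n=\prod_{k=0}^{n-1}(1-xq^k)$, and $(x_1,\dots,x_r;q)_n=\prod_{s=1}^r (x_s;q)_n$ (likewise with base $q^2$ in place of $q$). The basic hypergeometric series is ${}_4\phi_3\left[\begin{matrix}a_0,a_1,a_2,a_3\\ b_1,b_2,b_3\end{matrix};q,z\right]=\sum_{k\ge0}\frac{(a_0,a_1,a_2,a_3;q)_k}{(q,b_1,b_2,b_3;q)_k}z^k$. Here one upper parameter is $q^{-n}$, so the series terminates and means the sum over $0\le k\le n$. Parameters are assumed to be such that no zero factor appears in a denominator of the displayed expressions. Square roots $q^{1/2},a^{1/2},c^{1/2}$ are fixed once and for all and used multiplicatively: $\sqrt{qac}=q^{1/2}a^{1/2}c^{1/2}$, $\sqrt{qa/c}=q^{1/2}a^{1/2}/c^{1/2}$, $(ac)^{i/2}=(a^{1/2}c^{1/2})^i$, $q^{5i/2}=(q^{1/2})^{5i}$. *)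

(* Defs.v *)
From mathcomp Require Import all_boot all_order all_algebra.

Set Implicit Arguments.
Unset Strict Implicit.
Unset Printing Implicit Defensive.

Import GRing.Theory.
Local Open Scope ring_scope.

Definition qpoch (F : fieldType) (x q : F) (n : nat) : F :=
  \prod_(k < n) (1 - x * q ^+ k).

Definition qpochs (F : fieldType) (xs : seq F) (q : F) (n : nat) : F :=
  \prod_(x <- xs) qpoch x q n.

(* The terminating series 4phi3[a0, a1, a2, a3; b1, b2, b3; q, z], meant for
   the case where q^-n is one of the upper parameters: it is the sum over
   0 <= k <= n.  The cut-off n is explicit, since the ratio of q-shifted
   factorials may be of the form 0/0 for k > n (here because of the lower
   parameter q^(m-2n)). *)
Definition phi43 (F : fieldType) (n : nat)
    (a0 a1 a2 a3 b1 b2 b3 q z : F) : F :=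
  \sum_(k < n.+1)
    qpochs [:: a0; a1; a2; a3] q k / qpochs [:: q; b1; b2; b3] q k * z ^+ k.

(* Main.v *)
Require Import Defs.
From mathcomp Require Import all_boot all_order all_algebra.
From mathcomp Require Import reals complex.
From mathcomp Require Import ring zify.

Import GRing.Theory.
Local Open Scope ring_scope.

Set Implicit Arguments.
Unset Strict Implicit.
Unset Printing Implicit Defensive.

(* Two terminating 6phi5 sums reduce the 4phi3 series to Jain's q-Watson sum
     4phi3[A, C, q^-N, -q^-N; sqrt(qAC), -sqrt(qAC), q^-2N; q, q]
       = (qA, qC; q^2)_N / (q, qAC; q^2)_N.
   The first, with base a/c, writes (q^l a, c)_k / (sqrt(qac))_k as a
   combination over i of (q^(2l-i) a, q^i c)_k / (q^l sqrt(qac))_k, and so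
   makes the two lower parameters opposite; the second, with base q^(-2n-1),
   writes (-q^(m-n))_k / (q^(m-2n))_k as a combination over j of
   (-q^(j-n))_(k-j) / (q^(2j-2n))_(k-j) and leaves Jain's sum with
   N = n - j, A = q^(2l-i+j) a and C = q^(i+j) c. The 6phi5 and Jain sums are
   both proved by induction on their length, with WZ certificates. *)

(** * Elementary identities for q-shifted factorials *)

Section QPochhammer.
Variable F : fieldType.
Implicit Types (x q : F) (n : nat).

Lemma qpoch0 x q : qpoch x q 0 = 1.
Proof. by rewrite /qpoch big_ord0. Qed.

Lemma qpochSr x q n : qpoch x q n.+1 = qpoch x q n * (1 - x * q ^+ n).
Proof. by rewrite /qpoch big_ord_recr. Qed.

Lemma qpochD x q m n : qpoch x q (m + n) = qpoch x q m * qpoch (x * q ^+ m) q n.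
Proof.
elim: n => [|n IH]; first by rewrite addn0 qpoch0 mulr1.
by rewrite addnS !qpochSr IH exprD !mulrA.
Qed.

Lemma qpochSl x q n : qpoch x q n.+1 = (1 - x) * qpoch (x * q) q n.
Proof. by rewrite -add1n qpochD qpochSr qpoch0 mul1r expr0 mulr1 expr1. Qed.

Lemma qpoch1 x q : qpoch x q 1 = 1 - x.
Proof. by rewrite qpochSr qpoch0 mul1r expr0 mulr1. Qed.

Lemma qpoch_neq0P x q n :
  reflect (forall k, (k < n)%N -> 1 - x * q ^+ k != 0) (qpoch x q n != 0).
Proof.
apply: (iffP (prodf_neq0 _ _)) => [H k ltkn | H k _]; last exact: H.
by have /(_ isT) := H (Ordinal ltkn).
Qed.

Lemma qpoch_neq0_sub x q n m k :
  qpoch x q n != 0 -> (m + k <= n)%N -> qpoch (x * q ^+ m) q k != 0.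
Proof.
move=> H /subnKC nE; move: H.
by rewrite -nE !qpochD !mulf_eq0 !negb_or => /andP[/andP[]].
Qed.

Lemma qpoch_neq0_leq x q n k : qpoch x q n != 0 -> (k <= n)%N -> qpoch x q k != 0.
Proof. by move=> H /(@qpoch_neq0_sub x q n 0 k H); rewrite expr0 mulr1. Qed.

Lemma qpoch_sqr x q n : qpoch x q n * qpoch (- x) q n = qpoch (x ^+ 2) (q ^+ 2) n.
Proof.
elim: n => [|n IH]; first by rewrite !qpoch0 mulr1.
by rewrite !qpochSr -IH -exprM mulnC exprM; ring.
Qed.

(* (q^(1-n)/x)_i is, up to a monomial, the product of the last i factors of (x)_n. *)
Lemma qpoch_reflect x q n i : x != 0 -> q != 0 -> (i <= n)%N ->
  qpoch (q / (x * q ^+ n)) q i * qpoch x q (n - i) =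
  (-1) ^+ i * q ^+ 'C(i, 2) * (q / (x * q ^+ n)) ^+ i * qpoch x q n.
Proof.
move=> x0 q0; elim: i => [|i IH] lein; first by rewrite subn0 !qpoch0 !expr0 !mul1r.
move/(_ (ltnW lein)): IH; rewrite -(subnSK lein) !qpochSr binS bin1 exprD.
rewrite ![_ ^+ i.+1]exprSr; set r := (n - i.+1)%N; set p := q / _.
have -> : 1 - p * q ^+ i = (1 - x * q ^+ r) * (- p * q ^+ i).
  have Eqn : q ^+ n = q ^+ r * (q * q ^+ i) by rewrite -exprS -exprD subnK.
  have qr : q ^+ r != 0 by rewrite expf_neq0.
  have qi : q ^+ i != 0 by rewrite expf_neq0.
  by rewrite /p Eqn; field; rewrite x0 q0 qi qr.
move=> H; transitivity (qpoch p q i * (qpoch x q r * (1 - x * q ^+ r)) * (- p * q ^+ i)).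
  by ring.
by rewrite H; ring.
Qed.


(** Reflection at x = q makes (q^-n)_i times (q)_(n-i) a unit multiple of (q)_n, so a zero of the
    first factor would force (q)_n = 0. *)
Lemma qpochV_neq0 q n i : q != 0 -> qpoch q q n != 0 -> (i <= n)%N ->
  qpoch (q ^+ n)^-1 q i != 0.
Proof.
move=> q0 Hq lein; have := qpoch_reflect q0 q0 lein.
have -> : q / (q * q ^+ n) = (q ^+ n)^-1 by rewrite invfM mulrA divff // mul1r.
move/eqP; apply: contraTneq => ->; rewrite mul0r eq_sym.
by rewrite !mulf_neq0 // !expf_neq0 // ?oppr_eq0 ?oner_neq0 // invr_neq0 ?expf_neq0.
Qed.

End QPochhammer.

(** * The terminating very-well-poised 6phi5 sum *)

Section Sum6phi5.
Variables (F : fieldType) (q a b d : F).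
Hypotheses (q0 : q != 0) (b0 : b != 0) (d0 : d != 0).

(** The usual j-th term with upper parameters a, b, d, q^-N, multiplied by (aq/b)_N / ((q)_N
    (aq)_N). The very-well-poised factor 1 - a q^(2j) has been cancelled against (a q^j)_(N+1),
    which leaves the two products (a q^j)_j and (a q^(2j+1))_(N-j). No square root of a is
    involved. *)
Definition vwp_term N j : F :=
  q ^+ 'C(j, 2) * (- (a * q / (b * d))) ^+ j
  * (qpoch b q j * qpoch d q j * qpoch (a * q ^+ j.+1 / b) q (N - j))
  / (qpoch q q j * qpoch q q (N - j) * qpoch (a * q ^+ j) q j
     * qpoch (a * q ^+ (j + j).+1) q (N - j) * qpoch (a * q / d) q j).

(** The quotient of the closed forms in [sum_6phi5] at N + 1 and at N. *)
Definition vwp_ratio N : F :=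
  (1 - a * q ^+ N.+1 / (b * d)) / ((1 - q ^+ N.+1) * (1 - a * q ^+ N.+1 / d)).

(** The WZ certificate: for K <= N it is the sum over j <= K of [vwp_term N.+1 j - vwp_ratio N *
    vwp_term N j]. *)
Definition vwp_cert N K : F :=
  q ^+ 'C(K, 2) * (- (a * q / (b * d))) ^+ K
  * (qpoch b q K.+1 * qpoch d q K.+1 * qpoch (a * q ^+ K.+1 / b) q (N - K))
  / (qpoch q q K * qpoch q q (N - K) * qpoch (a * q ^+ K.+1) q N.+1
     * qpoch (a * q / d) q K)
  * (a * q ^+ N.+1 / (b * d)) / ((1 - q ^+ N.+1) * (1 - a * q ^+ N.+1 / d)).

(** Parametrising N by r replaces every truncated difference by r or r + 1. Once the boundary
    factors are split off, the four terms share their products and a rational identity in q^K and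
    q^r remains. *)
Lemma vwp_step K r (N := (K.+1 + r)%N) :
  qpoch q q N.+1 != 0 -> qpoch (a * q) q (N.+1 + N.+1) != 0 ->
  qpoch (a * q / d) q N.+1 != 0 ->
  vwp_term N.+1 K.+1 - vwp_ratio N * vwp_term N K.+1
  = vwp_cert N K.+1 - vwp_cert N K.
Proof.
have leN : (K + (K.+1 + (1 + (r + 1))) <= N.+1 + N.+1)%N by rewrite /N; lia.
move=> Hq Ha Hd; rewrite /vwp_term /vwp_cert /vwp_ratio.
have leKN : (K.+1 <= N.+1)%N by apply: leqW; apply: leq_addr.
have nq1 : qpoch q q K.+1 != 0 by exact: qpoch_neq0_leq Hq leKN.
have nq2 : qpoch q q r.+1 != 0.
  by apply: qpoch_neq0_leq Hq _; apply: leq_addl.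
have nd : qpoch (a * q / d) q K.+1 != 0 by exact: qpoch_neq0_leq Hd leKN.
have nqN : 1 - q ^+ N.+1 != 0 by rewrite exprS; move/qpoch_neq0P: Hq; apply.
have ndN : 1 - a * q ^+ N.+1 / d != 0.
  by move/qpoch_neq0P/(_ N (ltnSn _)): Hd; rewrite mulrAC -[a * q * _]mulrA -exprS.
(* (a q^(K+1))_(N+2) is a common multiple of the products with arguments a q^e in all four
   denominators; its nonvanishing gives that of each piece. *)
have EL : qpoch (a * q ^+ K.+1) q (K.+1 + (1 + (r + 1))) =
   qpoch (a * q ^+ K.+1) q K.+1 * ((1 - a * q ^+ (K.+1 + K.+1)) *
   (qpoch (a * q ^+ (K.+1 + K.+1).+1) q r * (1 - a * q ^+ (K.+1 + K.+1 + r).+1))).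
  by rewrite !qpochD !qpoch1 -!mulrA -!exprD !(addn1, add1n, addnS, addSn) addnA.
have : qpoch (a * q ^+ K.+1) q (K.+1 + (1 + (r + 1))) != 0.
  by rewrite exprS mulrA; apply: qpoch_neq0_sub Ha _.
rewrite EL !mulf_eq0 !negb_or => /and4P[nP n2 nQ1 nQ2].
have n1 : 1 - a * q ^+ K.+1 != 0.
  by rewrite exprS mulrA; move/qpoch_neq0P: Ha; apply; rewrite ltn_addr.
have -> : qpoch (a * q ^+ K.+2) q N.+1 = qpoch (a * q ^+ K.+1) q (K.+1 + (1 + (r + 1)))
    / (1 - a * q ^+ K.+1).
  have -> : (K.+1 + (1 + (r + 1)) = N.+2)%N by rewrite add1n addn1 !addnS.
  by rewrite [in RHS]qpochSl [RHS]mulrAC divff // mul1r -mulrA -exprSr.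
rewrite EL.
have -> : qpoch (a * q ^+ K.+1) q N.+1 =
   qpoch (a * q ^+ K.+1) q K.+1 * ((1 - a * q ^+ (K.+1 + K.+1)) *
   qpoch (a * q ^+ (K.+1 + K.+1).+1) q r).
  by rewrite {1}/N -addnS qpochD [qpoch _ _ r.+1]qpochSl -!mulrA -exprSr -!exprD !addnS.
have -> : (N.+1 - K.+1 = r.+1)%N by rewrite subSS /N addSnnS addKn.
have -> : (N - K.+1 = r)%N by rewrite addKn.
have -> : (N - K = r.+1)%N by rewrite /N addSnnS addKn.
rewrite [qpoch (a * q ^+ K.+1 / b) q r.+1]qpochSl.
have -> : a * q ^+ K.+1 / b * q = a * q ^+ K.+2 / b by rewrite [q ^+ K.+2]exprSr; ring.
move: n1 n2 nP nQ1 nQ2 nq1 nq2 nd nqN ndN.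
rewrite ![qpoch b q _.+1]qpochSr ![qpoch d q _.+1]qpochSr ![qpoch q q _.+1]qpochSr.
rewrite ![qpoch _ q r.+1]qpochSr ![qpoch (a * q / d) _ _]qpochSr.
rewrite /N binS bin1 !mulf_eq0 !negb_or.
move: (qpoch b q K) (qpoch d q K) (qpoch q q K) (qpoch q q r).
move: (qpoch (a * q ^+ K.+1) q K.+1) (qpoch (a * q ^+ (K.+1 + K.+1).+1) q r) => P Q.
move: (qpoch (a * q / d) q K) (qpoch (a * q ^+ K.+2 / b) q r).
rewrite !(addSn, addnS, exprS, exprD, addn0).
move: (q ^+ K) (q ^+ r) (q ^+ 'C(K, 2)) ((- (a * q / (b * d))) ^+ K).
move=> y R cb pw ?????? n1 n2 nP nQ1 nQ2 /andP[nq1 nq2] /andP[nr1 nr2] /andP[nd1 nd2]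
  nZ nZd.
(* [field] clears the inverse of d, so its side conditions carry d - aqy in place of 1 - aqy/d. *)
have {}nd2 : d - a * q * y != 0.
  have -> : d - a * q * y = d * (1 - a * q / d * y) by field.
  by rewrite mulf_neq0.
have {}nZd : d - a * (q * (q * y * R)) != 0.
  have -> : d - a * (q * (q * y * R)) = d * (1 - a * (q * (q * y * R)) / d) by field.
  by rewrite mulf_neq0.
field; do ?[apply/andP; split]; by [].
Qed.

Lemma vwp_step0 N :
  qpoch q q N.+1 != 0 -> qpoch (a * q) q (N.+1 + N.+1) != 0 ->
  qpoch (a * q / d) q N.+1 != 0 ->
  vwp_term N.+1 0 - vwp_ratio N * vwp_term N 0 = vwp_cert N 0.
Proof.
move=> Hq Ha Hd; rewrite /vwp_term /vwp_cert /vwp_ratio !subn0 add0n.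
have nqN : 1 - q ^+ N.+1 != 0 by rewrite exprS; move/qpoch_neq0P: Hq; apply.
have ndN : 1 - a * q ^+ N.+1 / d != 0.
  by move/qpoch_neq0P/(_ N (ltnSn _)): Hd; rewrite mulrAC -[a * q * _]mulrA -exprS.
have nq : qpoch q q N != 0 by apply: qpoch_neq0_leq Hq _.
have : qpoch (a * q) q N.+1 != 0 by apply: qpoch_neq0_leq Ha (leq_addr _ _).
move: nqN ndN nq; rewrite !qpoch1 !expr1 !qpochSr !qpoch0 mulf_eq0 negb_or.
rewrite bin0n !expr0 !exprS.
move: (qpoch (a * q) q N) (qpoch (a * q / b) q N) (qpoch q q N) (q ^+ N).
move=> P B Q Z nZ nZd nQ /andP[nP naZ].
have {}nZd : d - a * (q * Z) != 0.
  have -> : d - a * (q * Z) = d * (1 - a * (q * Z) / d) by field.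
  by rewrite mulf_neq0.
by field; rewrite nZ nZd nQ nP naZ b0 d0.
Qed.

(** The sum for N + 1 has one more term than the sum for N. That term cancels the boundary value of
    the certificate, so the recurrence in N is homogeneous. *)
Lemma vwp_last N :
  qpoch q q N.+1 != 0 -> qpoch (a * q) q (N.+1 + N.+1) != 0 ->
  qpoch (a * q / d) q N.+1 != 0 ->
  vwp_term N.+1 N.+1 + vwp_cert N N = 0.
Proof.
move=> Hq Ha Hd; rewrite /vwp_term /vwp_cert !subnn !qpoch0.
have nqN : 1 - q ^+ N.+1 != 0 by rewrite exprS; move/qpoch_neq0P: Hq; apply.
have ndN : 1 - a * q ^+ N.+1 / d != 0.
  by move/qpoch_neq0P/(_ N (ltnSn _)): Hd; rewrite mulrAC -[a * q * _]mulrA -exprS.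
have nq : qpoch q q N != 0 by apply: qpoch_neq0_leq Hq _.
have nd : qpoch (a * q / d) q N != 0 by apply: qpoch_neq0_leq Hd _.
have : qpoch (a * q ^+ N.+1) q N.+1 != 0.
  by rewrite exprS mulrA; apply: qpoch_neq0_sub Ha _; rewrite leq_add2r.
rewrite ![qpoch (a * q / d) _ _.+1]qpochSr ![qpoch q q _.+1]qpochSr.
rewrite binS bin1 !exprD !exprS.
move: nqN ndN nq nd; rewrite !exprS.
move: (qpoch (a * (q * q ^+ N)) q N.+1) (qpoch b q N.+1) (qpoch d q N.+1).
move: (qpoch q q N) (qpoch (a * q / d) q N) (q ^+ N) (q ^+ 'C(N, 2)).
move: ((- (a * q / (b * d))) ^+ N).
move=> pw Q D Z cb P B E nZ nZd nQ nD nP.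
have {}nZd : d - a * q * Z != 0.
  have -> : d - a * q * Z = d * (1 - a * (q * Z) / d) by field.
  by rewrite mulf_neq0.
by field; rewrite !mulrA in nZ nZd *; rewrite nZ nZd nQ nP nD b0 d0.
Qed.

(* The terminating 6phi5 sum, multiplied out in b so that it also covers
   the values of b for which a factor of (aq/b;q)_N vanishes. *)
Lemma sum_6phi5 N :
  qpoch q q N != 0 -> qpoch (a * q) q (N + N) != 0 ->
  qpoch (a * q / d) q N != 0 ->
  \sum_(j < N.+1) vwp_term N j
  = qpoch (a * q / (b * d)) q N / (qpoch q q N * qpoch (a * q / d) q N).
Proof.
elim: N => [|N IH] Hq Ha Hd.
  by rewrite big_ord1 /vwp_term !qpoch0 !expr0 !mulr1.
have tele K : (K <= N)%N ->
    \sum_(j < K.+1) vwp_term N.+1 j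
    = vwp_ratio N * (\sum_(j < K.+1) vwp_term N j) + vwp_cert N K.
  elim: K => [|K IHK] leKN.
    by rewrite !big_ord1 -vwp_step0 // addrC subrK.
  have [r EN] : {r | N = (K.+1 + r)%N} by exists (N - K.+1)%N; rewrite subnKC.
  rewrite big_ord_recr [in RHS]big_ord_recr /= IHK 1?ltnW // mulrDr.
  have := @vwp_step K r; rewrite -EN => /(_ Hq Ha Hd) /eqP.
  by rewrite subr_eq => /eqP ->; ring.
rewrite big_ord_recr /= tele // -addrA [vwp_cert _ _ + _]addrC vwp_last // addr0.
rewrite IH; first last.
- exact: qpoch_neq0_leq Hd _.
- by apply: qpoch_neq0_leq Ha _; rewrite leq_add.
- exact: qpoch_neq0_leq Hq _.
move: Hq Hd; rewrite !qpochSr /vwp_ratio !mulf_eq0 !negb_or exprS.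
move: (qpoch (a * q / d) q N) (qpoch q q N) (q ^+ N) (qpoch (a * q / (b * d)) q N).
move=> D Q Z P /andP[nQ nZ] /andP[nD nZd].
have {}nZd : d - a * q * Z != 0.
  have -> : d - a * q * Z = d * (1 - a * q / d * Z) by field.
  by rewrite mulf_neq0.
by field; rewrite ?mulrA in nZ nZd *; rewrite nZ nZd nQ nD b0 d0.
Qed.
End Sum6phi5.

(** * Jain's q-Watson sum *)

Section Jain.
Variables (F : fieldType) (q A C : F).
Hypothesis q0 : q != 0.

(** For x = q^-2N, (x;q^2)_k is (q^-N, -q^-N; q)_k, and (qAC;q^2)_k likewise merges the two opposite
    lower parameters, so no square root is needed. Keeping x free turns the passage from N + 1 to N
    into the shift from x to x q^2. *)
Definition jain_term x k : F :=
  qpoch A q k * qpoch C q k * qpoch x (q ^+ 2) k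
  / (qpoch q q k * qpoch (q * A * C) (q ^+ 2) k * qpoch x q k) * q ^+ k.

(** At x = q^(-2n-2), the quotient of the closed forms in [jain_sum] at n + 1 and at n. *)
Definition jain_ratio x : F :=
  (x * q - A) * (x * q - C) / ((x * q - 1) * (x * q - A * C)).

Definition jain_cert x k : F :=
  x * q / ((1 - x * q) * (x * q - A * C)) * jain_term (x * q ^+ 2) k
  * ((1 - A * q ^+ k) * (1 - C * q ^+ k) / q ^+ k).

(** By (x)_(k+1) (1 - x q^(k+1)) = (1 - x)(1 - xq)(x q^2)_k, the term at x is expressed through the
    products that occur at x q^2, so that [field] can compare the two. *)
Lemma jain_termS x k :
  qpoch q q k.+1 != 0 -> qpoch (q * A * C) (q ^+ 2) k.+1 != 0 ->
  qpoch x q k.+2 != 0 ->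
  jain_term x k.+1 =
  qpoch A q k.+1 * qpoch C q k.+1 * qpoch (x * q ^+ 2) (q ^+ 2) k
  * (1 - x * q ^+ k.+1)
  / (qpoch q q k.+1 * qpoch (q * A * C) (q ^+ 2) k.+1 * qpoch (x * q ^+ 2) q k
     * (1 - x * q)) * q ^+ k.+1.
Proof.
move=> Hq HAC Hx; rewrite /jain_term [qpoch x (q ^+ 2) _]qpochSl.
have Ex : qpoch x q k.+1 * (1 - x * q ^+ k.+1)
    = (1 - x) * ((1 - x * q) * qpoch (x * q ^+ 2) q k).
  by rewrite -qpochSr 2!qpochSl -mulrA -expr2.
move: (Hx); rewrite qpochSr mulf_eq0 negb_or => /andP[nx nxk].
move: Hx; rewrite qpochSr Ex !mulf_eq0 !negb_or => /and3P[n1 n2 n3].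
have -> : qpoch x q k.+1 = (1 - x) * ((1 - x * q) * qpoch (x * q ^+ 2) q k) / (1 - x *
  q ^+ k.+1).
  by rewrite -Ex mulfK.
move: Hq HAC n3; move: (qpoch q q k.+1) (qpoch (q * A * C) (q ^+ 2) k.+1) => Q P.
move: (qpoch (x * q ^+ 2) q k) (qpoch (x * q ^+ 2) (q ^+ 2) k) => X X2 nQ nP nX.
by field; rewrite n1 n2 nxk nQ nP nX.
Qed.

Lemma jain_step (x : F) k : x != 0 -> x * q - A * C != 0 ->
  qpoch q q k.+1 != 0 -> qpoch (q * A * C) (q ^+ 2) k.+1 != 0 ->
  qpoch x q k.+3 != 0 ->
  jain_term x k.+1 - jain_ratio x * jain_term (x * q ^+ 2) k.+1
  = jain_cert x k.+1 - jain_cert x k.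
Proof.
move=> x0 nAC Hq HAC Hx; rewrite jain_termS //; last exact: qpoch_neq0_leq Hx _.
rewrite /jain_cert /jain_term /jain_ratio; move: Hq HAC Hx.
rewrite [qpoch x _ _]qpochSl [qpoch (x * q) _ _]qpochSl !qpochSr -!exprM mulnC !exprM
  !exprS expr0 mulr1 !mulf_eq0 !negb_or.
have : q ^+ k != 0 by rewrite expf_neq0.
rewrite -[x * q * q]mulrA.
move: (qpoch A q k) (qpoch C q k) (qpoch q q k) (qpoch (q * A * C) _ k).
move: (qpoch (x * (q * q)) (q * q) k) (qpoch (x * (q * q)) q k) (q ^+ k).
move=> X2 X y A' C' Q P y0 /andP[nQ nq] /andP[nP nAy] /and3P[_ n1 /andP[nX n2]].
have n1' : x * q - 1 != 0 by rewrite -opprB oppr_eq0.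
move: nAy; rewrite expr0 mulr1 => nAy.
by field; rewrite y0 nX nP nQ nAC n1 q0 n2 nAy nq n1'.
Qed.

Lemma jain_step0 x : x * q - A * C != 0 -> qpoch x q 2 != 0 ->
  jain_term x 0 - jain_ratio x * jain_term (x * q ^+ 2) 0 = jain_cert x 0.
Proof.
move=> nAC; rewrite qpochSr qpoch1 mulf_eq0 negb_or expr1 => /andP[nx nxq].
rewrite /jain_cert /jain_term /jain_ratio !qpoch0 !expr0.
have nxq' : x * q - 1 != 0 by rewrite -opprB oppr_eq0.
by field; rewrite oner_neq0 nAC nxq nxq'.
Qed.

(** Here x = q^-2N with N = k + 1. The last term, which has no partner in the sum for N - 1, cancels
    the boundary value of the certificate. *)
Lemma jain_last x k : x * q ^+ (k.+1 + k.+1) = 1 ->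
  qpoch q q k.+1 != 0 -> qpoch (q * A * C) (q ^+ 2) k.+1 != 0 ->
  qpoch x q k.+2 != 0 ->
  jain_term x k.+1 + jain_cert x k = 0.
Proof.
move=> Ex Hq HAC Hx; rewrite jain_termS //.
rewrite /jain_cert /jain_term; move: Ex Hq HAC Hx.
rewrite exprD [qpoch x _ _]qpochSl [qpoch (x * q) _ _]qpochSl !qpochSr -!exprM mulnC
  !exprM !exprS expr0 mulr1 !mulf_eq0 !negb_or.
have : q ^+ k != 0 by rewrite expf_neq0.
rewrite -[x * q * q]mulrA.
move: (qpoch A q k) (qpoch C q k) (qpoch q q k) (qpoch (q * A * C) _ k).
move: (qpoch (x * (q * q)) (q * q) k) (qpoch (x * (q * q)) q k) (q ^+ k).
move=> X2 X y A' C' Q P y0 Ex /andP[nQ nq] /andP[nP nAy] /and3P[_ n1 nX].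
have nqy : q * y != 0 by rewrite mulf_neq0.
have {Ex} Ex : x = (q * y * (q * y))^-1.
  by apply: (mulIf (mulf_neq0 nqy nqy)); rewrite Ex mulVf // mulf_neq0.
move: nAy; rewrite expr0 mulr1 => nAy.
have ny : q * y * y - 1 != 0.
  have -> : q * y * y - 1 = (1 - x * q) * (q * y * y).
    by rewrite Ex; field; rewrite q0 y0.
  by rewrite !mulf_neq0.
have {}ny : y * (q * y) - 1 != 0 by rewrite mulrCA mulrA.
have {}nAy : 1 + - (A * C) * (y * (q * y)) != 0.
  by rewrite (_ : _ + _ = 1 - q * A * C * (y * y)) //; ring.
by rewrite Ex; field; rewrite y0 nX nP nQ q0 nAy ny nq.
Qed.

Lemma jain_sum n :
  qpoch q q (n + n) != 0 -> qpoch (q * A * C) (q ^+ 2) n != 0 ->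
  \sum_(k < n.+1) jain_term (q ^+ (n + n))^-1 k
  = qpoch (q * A) (q ^+ 2) n * qpoch (q * C) (q ^+ 2) n
    / (qpoch q (q ^+ 2) n * qpoch (q * A * C) (q ^+ 2) n).
Proof.
elim: n => [|n IH] Hq HAC.
  by rewrite big_ord1 /jain_term !qpoch0 expr0 !mulr1.
set x := (q ^+ _)^-1.
have x0 : x != 0 by rewrite invr_neq0 ?expf_neq0.
(* The recurrence needs (x)_i up to i = n + 2, which stays within the 2n + 2 factors covered by
   [qpochV_neq0]. *)
have Hx i : (i <= n.+2)%N -> qpoch x q i != 0.
  by move=> lei; apply: qpochV_neq0 => //; apply: leq_trans lei _; lia.
have Hqn : qpoch q q n.+1 != 0 by apply: qpoch_neq0_leq Hq _; lia.
have Ex : x * q ^+ 2 = (q ^+ (n + n))^-1.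
  by rewrite /x addSn addnS !exprS; field; rewrite q0 expf_neq0.
have nqn : 1 - q * (q ^+ n * q ^+ n) != 0.
  by rewrite -exprD; move/qpoch_neq0P: Hq; apply; lia.
have nACn : 1 - q * A * C * (q ^+ n * q ^+ n) != 0.
  by rewrite -expr2 -exprM mulnC exprM; move/qpoch_neq0P: HAC; apply.
have qn0 : q ^+ n != 0 by rewrite expf_neq0.
have xE : x = (q * q ^+ n * (q * q ^+ n))^-1 by rewrite -exprS -exprD.
have nAC : x * q - A * C != 0.
  have -> : x * q - A * C = (1 - q * A * C * (q ^+ n * q ^+ n)) / (q * (q ^+ n * q ^+ n)).
    by rewrite xE; field; rewrite q0 qn0.
  by rewrite mulf_neq0 // invr_neq0 // !mulf_neq0.
have tele K : (K <= n)%N ->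
    \sum_(j < K.+1) jain_term x j
    = jain_ratio x * (\sum_(j < K.+1) jain_term (x * q ^+ 2) j) + jain_cert x K.
  elim: K => [|K IHK] leKn.
    by rewrite !big_ord1 -jain_step0 ?Hx // addrC subrK.
  rewrite big_ord_recr [in RHS]big_ord_recr /= IHK 1?ltnW // mulrDr.
  have leK1 : (K.+1 <= n.+1)%N by exact: ltnW.
  have := jain_step x0 nAC (qpoch_neq0_leq Hqn leK1) (qpoch_neq0_leq HAC leK1) (Hx _ _).
  by move=> /(_ leKn) /eqP; rewrite subr_eq => /eqP ->; ring.
rewrite big_ord_recr /= tele // -addrA [jain_cert _ _ + _]addrC jain_last ?Hx //
  ?addr0; last first.
  by rewrite mulVf // expf_neq0.
rewrite Ex IH; first last.
- exact: qpoch_neq0_leq HAC _.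
- by apply: qpoch_neq0_leq Hq _; rewrite leq_add.
have : qpoch q (q ^+ 2) n.+1 != 0.
  apply/qpoch_neq0P => i lei; rewrite -exprM.
  by move/qpoch_neq0P: Hq; apply; lia.
move: HAC; rewrite /jain_ratio !qpochSr -!exprM mulnC exprM expr2 xE !mulf_eq0 !negb_or.
move: (qpoch (q * A * C) (q * q) n) (qpoch q (q * q) n) => P Q.
move=> /andP[nP _] /andP[nQ _].
move: (q ^+ n) qn0 nqn nACn (qpoch (q * A) _ n) (qpoch (q * C) _ n) => y y0 nq nA P1 P2.
rewrite -expr2 in nq nA.
by field; rewrite nA nP nq nQ y0 q0.
Qed.

End Jain.

(** * The expansion over j and its reduction to Jain's sum *)

Lemma sum_triangle (V : nmodType) n (g : nat -> nat -> V) :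
  \sum_(k < n.+1) \sum_(j < k.+1) g j (k - j)%N
  = \sum_(j < n.+1) \sum_(i < (n - j).+1) g j i.
Proof.
elim: n => [|n IH]; first by rewrite !big_ord1.
rewrite big_ord_recr IH [RHS]big_ord_recr [X in _ + X = _]big_ord_recr /= !subnn
  big_ord1 addrA.
congr (_ + _); rewrite -big_split; apply: eq_bigr => j _ /=.
by rewrite (@subSn j n) -1?ltnS ?ltn_ord // [RHS]big_ord_recr.
Qed.

Section Expansions.
Variables (F : fieldType) (q : F).
Hypothesis q0 : q != 0.

(* In this section u and v stand for q^-n and q^-m. *)
Definition sh_coef (u v : F) j : F :=
  q ^+ 'C(j.+1, 2) * (u / v) ^+ j * (qpoch v q j * qpoch u q j * qpoch (- u) q j)
  / (qpoch q q j * qpoch (u ^+ 2 / v) q j * qpoch (u ^+ 2 * q ^+ j / q) q j).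

(** This is [sum_6phi5] with a = u^2/q, b = v, d = -u and N = k, multiplied by (u, -u)_k q^k /
    (u^2/v)_k. For this choice aq/d = -u = d, and aq/(bd) = -u/v is the parameter to be expanded. *)
Lemma shift_expansion (u v : F) k :
  u != 0 -> v != 0 -> qpoch q q k != 0 -> qpoch (u ^+ 2) q (k + k) != 0 ->
  qpoch (- u) q k != 0 -> qpoch (u ^+ 2 / v) q k != 0 ->
  qpoch u q k * qpoch (- (u / v)) q k / (qpoch q q k * qpoch (u ^+ 2 / v) q k)
    * q ^+ k
  = \sum_(j < k.+1) sh_coef u v j *
      (qpoch (u * q ^+ j) q (k - j) * qpoch (- u * q ^+ j) q (k - j)
       / (qpoch q q (k - j) * qpoch (u ^+ 2 * q ^+ (j + j)) q (k - j))
       * q ^+ (k - j)).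
Proof.
move=> u0 v0 Hq Hu Hu' Huv.
have Nu0 : - u != 0 by rewrite oppr_eq0.
have := @sum_6phi5 F q (u ^+ 2 / q) v (- u) q0 v0 Nu0 k Hq.
have -> : u ^+ 2 / q * q = u ^+ 2 by rewrite divfK.
have -> : u ^+ 2 / (v * - u) = - (u / v) by field; rewrite ?v0 ?u0 ?Nu0.
have -> : u ^+ 2 / (- u) = - u by field; rewrite ?Nu0 ?u0.
move=> /(_ Hu Hu') /(congr1 (fun z => z * (qpoch u q k * qpoch (- u) q k / qpoch (u ^+
  2 / v) q k * q ^+ k))) E.
have -> : qpoch u q k * qpoch (- (u / v)) q k / (qpoch q q k * qpoch (u ^+ 2 / v) q k)
    * q ^+ k = qpoch (- (u / v)) q k / (qpoch q q k * qpoch (- u) q k) *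
    (qpoch u q k * qpoch (- u) q k / qpoch (u ^+ 2 / v) q k * q ^+ k).
  by field; rewrite Hq Huv Hu'.
rewrite -E mulr_suml; apply: eq_bigr => j _.
have : (j <= k)%N by rewrite -ltnS.
move: (nat_of_ord j) => {E}j lejk.
rewrite /vwp_term /sh_coef.
have -> : u ^+ 2 / q * q / (v * - u) = - (u / v) by field; rewrite ?v0 ?u0 ?q0 ?Nu0.
have -> : u ^+ 2 / q * q / - u = - u by field; rewrite ?u0 ?q0 ?Nu0.
have -> : u ^+ 2 / q * q ^+ j.+1 / v = u ^+ 2 / v * q ^+ j.
  by rewrite [q ^+ j.+1]exprS; field; rewrite v0 q0.
have -> : u ^+ 2 / q * q ^+ j = u ^+ 2 * q ^+ j / q by rewrite mulrAC.
have -> : u ^+ 2 / q * q ^+ (j + j).+1 = u ^+ 2 * q ^+ (j + j).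
  by rewrite [q ^+ (j + j).+1]exprS mulrA divfK.
rewrite opprK binS bin1 [q ^+ ('C(j, 2) + j)]exprD.
(* The argument is u^2 q^(j-1), which for j = 0 precedes the factors covered by [Hu]; the product is
   then empty. *)
have Nj : qpoch (u ^+ 2 * q ^+ j / q) q j != 0.
  case: j lejk => [|j] lejk; first by rewrite qpoch0 oner_neq0.
  by rewrite [q ^+ j.+1]exprSr mulrA mulfK //; apply: qpoch_neq0_sub Hu _; lia.
have Njk : qpoch (u ^+ 2 * q ^+ (j + j)) q (k - j) != 0.
  by apply: qpoch_neq0_sub Hu _; lia.
have Nqj : qpoch q q j != 0 by exact: qpoch_neq0_leq Hq lejk.
have Nqr : qpoch q q (k - j) != 0 by apply: qpoch_neq0_leq Hq _; exact: leq_subr.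
move: Nj Njk Nqj Nqr; have := subnKC lejk; set r := (k - j)%N => Ek.
move: Hu' Huv; rewrite -Ek !qpochD [q ^+ (j + r)]exprD !mulf_eq0 !negb_or.
move=> /andP[nu nu'] /andP[n1 n2] Nj Njk Nqj Nqr.
move: nu nu' n1 n2 Nj Njk Nqj Nqr.
move: (qpoch (- u) q j) (qpoch (- u * q ^+ j) q r) (qpoch u q j) (qpoch (u * q ^+ j) q r).
move: (qpoch q q j) (qpoch q q r) (qpoch v q j).
move: (qpoch (u ^+ 2 / v) q j) (qpoch (u ^+ 2 / v * q ^+ j) q r).
move: (qpoch (u ^+ 2 * q ^+ j / q) q j) (qpoch (u ^+ 2 * q ^+ (j + j)) q r).
move: (q ^+ j) (q ^+ r) (q ^+ 'C(j, 2)) ((u / v) ^+ j).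
move=> x1 x2 x3 x4 x5 x6 x7 x8 x9 y1 y2 y3 y4 y5 y6 n1 n2 n3 n4 n5 n6 n7 n8.
by field; rewrite ?n1 ?n2 ?n3 ?n4 ?n5 ?n6 ?n7 ?n8.
Qed.

(* The case l = 0: each inner sum is Jain's sum with n, A, C replaced by
   n - j, A q^j, C q^j. *)
Lemma shifted_jain_sum (A C S u v : F) m n :
  (m <= n)%N -> S ^+ 2 = q * A * C -> u * q ^+ n = 1 -> v * q ^+ m = 1 ->
  qpoch q q (n + n) != 0 -> qpoch (S ^+ 2) (q ^+ 2) n != 0 ->
  \sum_(k < n.+1)
     qpoch A q k * qpoch C q k / (qpoch S q k * qpoch (- S) q k)
     * (qpoch u q k * qpoch (- (u / v)) q k
        / (qpoch q q k * qpoch (u ^+ 2 / v) q k) * q ^+ k)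
  = \sum_(j < m.+1)
     qpoch A q j * qpoch C q j / (qpoch S q j * qpoch (- S) q j) * sh_coef u v j
     * (qpoch (q * (A * q ^+ j)) (q ^+ 2) (n - j)
        * qpoch (q * (C * q ^+ j)) (q ^+ 2) (n - j)
        / (qpoch q (q ^+ 2) (n - j)
           * qpoch (q * (A * q ^+ j) * (C * q ^+ j)) (q ^+ 2) (n - j))).
Proof.
move=> lemn ES Eu Ev Hq HS.
have uE : u = (q ^+ n)^-1 by rewrite -[LHS](mulfK (_ : q ^+ n != 0)) ?Eu ?mul1r ?expf_neq0.
have vE : v = (q ^+ m)^-1 by rewrite -[LHS](mulfK (_ : q ^+ m != 0)) ?Ev ?mul1r ?expf_neq0.
have u0 : u != 0 by rewrite uE invr_neq0 ?expf_neq0.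
have v0 : v != 0 by rewrite vE invr_neq0 ?expf_neq0.
have u2E : u ^+ 2 = (q ^+ (n + n))^-1 by rewrite uE exprVn expr2 -exprD.
have Hu2 i : (i <= n + n)%N -> qpoch (u ^+ 2) q i != 0.
  by rewrite u2E; exact: qpochV_neq0.
(* Since u^2/v = u^2 q^m and m <= n, these factors lie among those of (u^2)_(2n). *)
have Huv i : (i <= n)%N -> qpoch (u ^+ 2 / v) q i != 0.
  rewrite vE invrK => lein; apply: qpoch_neq0_sub (Hu2 _ (leqnn _)) _; lia.
(* (u)_i (-u)_i = (u^2;q^2)_i, whose factors are every other factor of (u^2;q)_(2n). *)
have HNu i : (i <= n)%N -> qpoch (- u) q i != 0.
  move=> lein; have : qpoch u q i * qpoch (- u) q i != 0.
    rewrite qpoch_sqr; apply/qpoch_neq0P => k ltki; rewrite -exprM.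
    by move/qpoch_neq0P: (Hu2 _ (leqnn _)); apply; lia.
  by rewrite mulf_eq0 negb_or => /andP[].
pose G j i := qpoch A q j * qpoch C q j / (qpoch S q j * qpoch (- S) q j) * sh_coef u v j
  * jain_term q (A * q ^+ j) (C * q ^+ j) (u ^+ 2 * q ^+ (j + j)) i.
transitivity (\sum_(k < n.+1) \sum_(j < k.+1) G j (k - j)%N).
  apply: eq_bigr => k _; have lekn : (k <= n)%N by rewrite -ltnS.
  rewrite shift_expansion ?Hu2 ?HNu ?Huv //; first last.
  - by rewrite leq_add.
  - by apply: qpoch_neq0_leq Hq _; rewrite (leq_trans lekn) ?leq_addr.
  rewrite mulr_sumr; apply: eq_bigr => j _.
  have /subnKC : (j <= k)%N by rewrite -ltnS.
  move: (nat_of_ord j) (k - j)%N => {}j r <-; rewrite /G /jain_term !qpochD.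
  have -> : q * (A * q ^+ j) * (C * q ^+ j) = (S * q ^+ j) ^+ 2 by rewrite exprMn ES; ring.
  have -> : u ^+ 2 * q ^+ (j + j) = (u * q ^+ j) ^+ 2 by rewrite exprD exprMn; ring.
  by rewrite -!qpoch_sqr !mulNr !invfM; ring.
(* With j outermost, the range j <= n shrinks to j <= m, because (v)_j = (q^-m)_j vanishes for j >
   m. *)
rewrite sum_triangle -(big_mkord xpredT (fun j => \sum_(i < (n - j).+1) G j i))
  (@big_cat_nat _ _ _ m.+1) //= [X in _ + X]big1_seq ?addr0; last first.
  move=> j /andP[_]; rewrite mem_index_iota => /andP[ltmj _]; apply: big1 => i _.
  rewrite /G /sh_coef; suff -> : qpoch v q j = 0 by ring.
  apply/eqP; apply/negPn/negP => /qpoch_neq0P/(_ m ltmj); by rewrite Ev subrr eqxx.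
rewrite big_mkord; apply: eq_bigr => j _; rewrite -mulr_sumr.
have lejn : (j <= n)%N by rewrite (leq_trans _ lemn) // -ltnS.
(* The inner series runs up to n - j, exactly the length at which x = q^(-2(n-j)) makes Jain's sum
   terminate. *)
have -> : u ^+ 2 * q ^+ (j + j) = (q ^+ (n - j + (n - j)))^-1.
  rewrite u2E -[in LHS](subnK lejn); move: (n - j)%N => r.
  by rewrite !exprD; field; rewrite !expf_neq0.
congr (_ * _); apply: jain_sum => //.
  by apply: qpoch_neq0_leq Hq _; rewrite leq_add ?leq_subr.
have -> : q * (A * q ^+ j) * (C * q ^+ j) = S ^+ 2 * (q ^+ 2) ^+ j.
  by rewrite ES -exprM mulnC exprM; ring.
by apply: qpoch_neq0_sub HS _; rewrite subnKC.
Qed.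

End Expansions.

(** * The expansion over i, with base a/c *)

Lemma bin2_add i j : 'C(i + j, 2) = ('C(i, 2) + 'C(j, 2) + i * j)%N.
Proof. by elim: i => [|i IH]; rewrite ?addn0 // addSn !binS !bin1 IH mulSn; lia. Qed.

Section ParameterExpansion.
Variables (F : fieldType) (q : F).
Hypothesis q0 : q != 0.

(** This is [sum_6phi5] with a = al, b = x q^l al c, d = w and N = l, read backwards. As w^2 = q al,
    aq/d = w, so (d)_j and (aq/d)_j cancel in each term. Reflection turns the products in 1/x into
    products in x; the coefficients do not depend on x, which is later set to q^k. *)
Lemma well_poised_expansion (al w c x : F) l :
  al != 0 -> w ^+ 2 = q * al -> c != 0 -> x != 0 ->
  qpoch q q l != 0 -> qpoch al q (l + l).+1 != 0 -> qpoch w q l != 0 ->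
  \sum_(i < l.+1) w ^+ i *
    (qpoch (x * (q ^+ l * (al * c))) q (l - i) * qpoch (x * c) q i)
    / (qpoch q q i * qpoch q q (l - i) * qpoch (al * q ^+ (l - i)) q (l - i)
       * qpoch (al * q ^+ (l - i + (l - i)).+1) q i)
  = qpoch (x * (w * c)) q l / (qpoch q q l * qpoch w q l).
Proof.
move=> al0 Ew c0 x0 Hq Hal Hw.
have w0 : w != 0 by rewrite -sqrf_eq0 Ew mulf_neq0.
have ql i : q ^+ i != 0 by rewrite expf_neq0.
set b := x * (q ^+ l * (al * c)).
have b0 : b != 0 by rewrite !mulf_neq0.
have := @sum_6phi5 F q al b w q0 b0 w0 l Hq.
have awE : al * q / w = w by rewrite [al * q]mulrC -Ew expr2 mulfK.
have Hal' : qpoch (al * q) q (l + l) != 0.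
  by move: Hal; rewrite qpochSl mulf_eq0 negb_or => /andP[].
rewrite awE => /(_ Hal' Hw).
pose p := q / (x * (w * c) * q ^+ l).
have pE : al * q / (b * w) = p.
  by rewrite /b /p; field; rewrite w0 c0 x0 ql al0.
rewrite pE; have := @qpoch_reflect F (x * (w * c)) q l l.
rewrite subnn qpoch0 mulr1 -/p => -> //; last by rewrite !mulf_neq0.
have p0 : p != 0 by rewrite mulf_neq0 // invr_neq0 // !mulf_neq0.
(* The monomial produced by reflecting the right-hand side; dividing by it leaves w^i as the only
   monomial in the i-th term. *)
pose M := (-1) ^+ l * q ^+ 'C(l, 2) * p ^+ l.
have M0 : M != 0 by rewrite !mulf_neq0 ?expf_neq0 // oppr_eq0 oner_neq0.
rewrite -/M -mulrA => /(congr1 (fun z => M^-1 * z)); rewrite mulKf // => <-.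
rewrite mulr_sumr [RHS](reindex_inj rev_ord_inj) /=; apply: eq_bigr => i _.
have : (i <= l)%N by rewrite -ltnS.
move: (nat_of_ord i) => {}i leil; rewrite subSS /vwp_term pE subKn //.
rewrite awE; have Nq1 : qpoch q q i != 0 by exact: qpoch_neq0_leq Hq leil.
have Nq2 : qpoch q q (l - i) != 0 by apply: qpoch_neq0_leq Hq _; exact: leq_subr.
have Nw : qpoch w q (l - i) != 0 by apply: qpoch_neq0_leq Hw _; exact: leq_subr.
have Na1 : qpoch (al * q ^+ (l - i)) q (l - i) != 0.
  by apply: qpoch_neq0_sub Hal _; clear -leil; lia.
have Na2 : qpoch (al * q ^+ (l - i + (l - i)).+1) q i != 0.
  by apply: qpoch_neq0_sub Hal _; clear -leil; lia.
have := subnK leil; rewrite /M {M M0}; move: (l - i)%N Nq2 Nw Na1 Na2 => j Nq2 Nw Na1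
  Na2 El.
have -> : al * q ^+ j.+1 / b = q / (x * c * q ^+ i).
  by rewrite /b -El exprD exprS; field; rewrite c0 x0 !ql al0.
have := @qpoch_reflect F (x * c) q i i.
rewrite subnn qpoch0 mulr1 => -> //; last by rewrite mulf_neq0.
have -> : q / (x * c * q ^+ i) = w * p * q ^+ j.
  by rewrite /p -El exprD; field; rewrite w0 c0 x0 !ql.
have EC : 'C(l, 2) = ('C(j, 2) + 'C(i, 2) + j * i)%N by rewrite -El bin2_add.
clearbody p; rewrite EC -[in _ ^+ l]El -[in p ^+ l]El !exprD (exprM q j i) !exprMn [(-
  p) ^+ j]exprNn.
move: (w ^+ i) (expf_neq0 i w0) => wi nwi.
move: (p ^+ i) (expf_neq0 i p0) (p ^+ j) (expf_neq0 j p0) => p_i npi pj npj.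
have s0 k : ((-1) ^+ k : F) != 0 by rewrite expf_neq0 // oppr_eq0 oner_neq0.
move: ((-1) ^+ i) (s0 i) ((-1) ^+ j) (s0 j) => si nsi sj nsj.
move: (q ^+ 'C(i, 2)) (ql 'C(i, 2)) (q ^+ 'C(j, 2)) (ql 'C(j, 2)) => c1 nc1 c2 nc2.
move: ((q ^+ j) ^+ i) (expf_neq0 i (ql j)) => qji nqji.
move: (qpoch w q j) Nw (qpoch q q j) Nq2 (qpoch q q i) Nq1 => W nW Q1 nQ1 Q2 nQ2.
move: (qpoch (al * _) q j) Na1 (qpoch (al * _) q i) Na2 => A1 n1 A2 n2.
move: (qpoch _ q j) (qpoch _ q i) => B1 B2.
by field; rewrite nQ2 nQ1 n1 n2 nW npi npj nsi nsj nc1 nc2 nqji.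
Qed.

Section Coefficients.
Variables (rq ra rc a c al w : F) (l : nat).
Hypotheses (rqE : rq ^+ 2 = q) (raE : ra ^+ 2 = a) (rcE : rc ^+ 2 = c) (c0 : c != 0)
  (ra0 : ra != 0)
  (rc0 : rc != 0) (wE : w = rq * ra / rc) (alE : al = a / c).
Hypotheses (Hq : qpoch q q l != 0) (Ha : qpoch (q ^+ l * a) q l != 0)
  (Hal : qpoch al q (l + l).+1 != 0).

(** The factors of T_(i,j) that depend on i alone, with natural exponents of q; they agree with the
    integer ones for i <= l. *)
Definition wp_coef i : F :=
  rq ^+ (5 * i) * (1 / (ra * rc) ^+ i)
  * ((1 - al * q ^+ (l - i + (l - i))) / (1 - al * q ^+ (l + l)))
  * (qpoch (q ^+ l)^-1 q i * qpoch c q i * qpoch (q ^+ (l + l) * al)^-1 q i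
     / (qpoch q q i * qpoch (q / (q ^+ (l + l) * a)) q i
        * qpoch (q / (q ^+ l * al)) q i)).

(** Matches the coefficients of the theorem with those of [well_poised_expansion]: the four products
    with inverse powers of q are reflected. *)
Lemma wp_coefE i : (i <= l)%N ->
  qpoch (q ^+ l * a) q l / qpoch (al * q ^+ l) q l * wp_coef i
  = qpoch q q l * w ^+ i * qpoch (q ^+ l * a) q (l - i) * qpoch c q i
    / (qpoch q q i * qpoch q q (l - i) * qpoch (al * q ^+ (l - i)) q (l - i)
       * qpoch (al * q ^+ (l - i + (l - i)).+1) q i).
Proof.
move=> leil.
have ql k : q ^+ k != 0 by rewrite expf_neq0.
have rq0 : rq != 0 by apply: contraNneq q0 => rq0; rewrite -rqE rq0 expr0n.
have a0 : a != 0 by rewrite -raE expf_neq0.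
have al0 : al != 0 by rewrite alE mulf_neq0 ?invr_neq0.
have qal0 : q * al != 0 by rewrite mulf_neq0.
have qa0 : q ^+ l * a != 0 by rewrite mulf_neq0.
have leil2 : (i <= l + l)%N by rewrite (leq_trans leil) ?leq_addr.
have e1 : (l + l - i = l - i + (l - i) + i)%N by clear -leil; lia.
have e2 : (l - i + (l - i) + i <= l + l)%N by clear -leil; lia.
have R1 := qpoch_reflect q0 q0 leil.
have R2 := qpoch_reflect qa0 q0 leil.
have R3 := qpoch_reflect al0 q0 leil.
have R4 := qpoch_reflect qal0 q0 leil2.
have := Hal; rewrite qpochSl mulf_eq0 negb_or => /andP[nal Hqal].
(* [E1] and [E2] cut (al)_(2l+1) and (al)_(2l-i+1) so as to isolate the factors 1 - al q^(2l) and 1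
   - al q^(2l-2i) of [wp_coef]. *)
have E1 : (1 - al) * qpoch (q * al) q (l + l)
    = qpoch al q l * qpoch (al * q ^+ l) q l * (1 - al * q ^+ (l + l)).
  by rewrite [q * al]mulrC -qpochSl qpochSr qpochD.
have E2 : (1 - al) * qpoch (q * al) q (l + l - i)
    = qpoch al q (l - i) * qpoch (al * q ^+ (l - i)) q (l - i) * (1 - al * q ^+ (l - i
      + (l - i)))
      * qpoch (al * q ^+ (l - i + (l - i)).+1) q i.
  by rewrite e1 [q * al]mulrC -qpochSl -addSn qpochD qpochSr qpochD.
pose p2 := q / (q ^+ (l + l) * a); pose p3 := q / (q ^+ l * al).
have p1E : q / (q * q ^+ l) = (q ^+ l)^-1 by rewrite invfM mulrA divff // mul1r.
have p2E : q / (q ^+ l * a * q ^+ l) = p2 by rewrite /p2 mulrAC -exprD.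
have p3E : q / (al * q ^+ l) = p3 by rewrite /p3 [al * _]mulrC.
have p4E : q / (q * al * q ^+ (l + l)) = (q ^+ (l + l) * al)^-1.
  by rewrite -mulrA invfM mulrA divff // mul1r [al * _]mulrC.
rewrite p1E in R1; rewrite p2E in R2; rewrite p3E in R3; rewrite p4E in R4.
(* Two reflections occur in the numerator and two in the denominator, so the signs and the powers
   q^C(i,2) cancel; the remaining monomials combine with the prefactor into w^i. *)
have wiE : w ^+ i = rq ^+ (5 * i) * (1 / (ra * rc) ^+ i)
    * ((q ^+ l)^-1 ^+ i * (q ^+ (l + l) * al)^-1 ^+ i) / (p2 ^+ i * p3 ^+ i).
  rewrite exprM div1r -[((ra * rc) ^+ i)^-1]exprVn -[p2 ^+ i * p3 ^+ i]exprMn -[((p2 *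
    p3) ^+ i)^-1]exprVn -!exprMn; congr (_ ^+ _).
  rewrite /p2 /p3 wE alE -raE exprD -rqE; field.
  by rewrite ra0 rc0 c0 rq0 rqE ql.
rewrite /wp_coef -/p2 -/p3 wiE.
have : qpoch al q (l - i + (l - i) + i).+1 != 0 by apply: qpoch_neq0_leq Hal _; rewrite
  ltnS.
move: Hal; rewrite qpochSr [in X in X -> _]qpochD -mulrA -addSn.
rewrite [in X in _ -> X -> _]qpochD [in X in _ -> X -> _]qpochSr [in X in _ -> X ->
  _]qpochD.
rewrite !mulf_eq0 !negb_or => /and3P[n1 n2 n3] /andP[/andP[/andP[n4 n5] n6] n7].
have nU1 : qpoch q q (l - i) != 0 by apply: qpoch_neq0_leq Hq _; exact: leq_subr.
have nUi : qpoch q q i != 0 by exact: qpoch_neq0_leq Hq leil.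
have nU2 : qpoch (q ^+ l * a) q (l - i) != 0.
  by apply: qpoch_neq0_leq Ha _; exact: leq_subr.
have nU4 : qpoch (q * al) q (l + l - i) != 0.
  by apply: (qpoch_neq0_leq (n := l + l)); rewrite ?leq_subr // mulrC.
have U4E := canRL (mulKf nal) E2; have V4E := canRL (mulKf nal) E1.
rewrite (canRL (mulfK nU1) R1) (canRL (mulfK nU2) R2) (canRL (mulfK n4) R3).
rewrite (canRL (mulfK nU4) R4) U4E V4E.
have np2 : p2 ^+ i != 0 by rewrite expf_neq0 // mulf_neq0 // invr_neq0 // mulf_neq0.
have np3 : p3 ^+ i != 0 by rewrite expf_neq0 // mulf_neq0 // invr_neq0 // mulf_neq0.
have ns : (-1) ^+ i * q ^+ 'C(i, 2) != 0.
  by rewrite mulf_neq0 // expf_neq0 // oppr_eq0 oner_neq0.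
clear - Hq Ha nal n1 n2 n3 n4 n5 n6 n7 nU1 nUi nU2 np2 np3 ns.
move: (qpoch q q (l - i)) nU1 (qpoch q q i) nUi => ? ? ? ?.
move: (qpoch (q ^+ l * a) q (l - i)) nU2 (qpoch (q ^+ l * a) q l) Ha => ? ? ? ?.
move: (qpoch (al * q ^+ l) q l) n2 (1 - al * q ^+ (l + l)) n3 => ? ? ? ?.
move: (qpoch al q (l - i)) n4 (qpoch al q l) n1 => ? ? ? ?.
move: (qpoch (al * _) q (l - i)) n5 (qpoch (al * _) q i) n7 => ? ? ? ?.
move: (1 - al * _) n6 (1 - al) nal (_ * q ^+ 'C(i, 2)) ns => ? ? ? ? ? ?.
move: (p2 ^+ i) np2 (p3 ^+ i) np3 (qpoch q q l) Hq => ? ? ? ? ? ?.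
move: (_ ^+ i) (_ ^+ i) (1 / _) (rq ^+ _) (qpoch c q i) => ? ? ? ? ?.
by field; do ?[apply/andP; split].
Qed.

(** Since (s)_k (q^k s)_l = (s)_l (q^l s)_k, replacing (s)_k by (q^l s)_k costs (q^k s)_l, which
    [well_poised_expansion] expands at x = q^k. The products obtained merge with (q^l a)_k and (c)_k
    into (q^(2l-i) a)_k and (q^i c)_k. *)
Lemma parameter_expansion k (s := w * c) :
  qpoch s q l != 0 -> qpoch s q k != 0 -> qpoch (q ^+ l * s) q k != 0 ->
  qpoch (q ^+ l * a) q k * qpoch c q k / qpoch s q k
  = qpoch (q ^+ l * a) q l * qpoch w q l / (qpoch (al * q ^+ l) q l * qpoch s q l)
    * \sum_(i < l.+1) wp_coef i *
        (qpoch (q ^+ (l + (l - i)) * a) q k * qpoch (q ^+ i * c) q k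
         / qpoch (q ^+ l * s) q k).
Proof.
move=> nsl nsk nqs.
have al0 : al != 0 by rewrite alE mulf_neq0 ?invr_neq0 // -raE expf_neq0.
have w2 : w ^+ 2 = q * al.
  by rewrite wE alE -raE -rqE -rcE; field.
(* If w q^e = 1, then al q^(2e+1) = (w q^e)^2 = 1, and a factor of (al)_(2l+1) vanishes. *)
have nw : qpoch w q l != 0.
  apply/qpoch_neq0P => e ltel; apply/eqP => /eqP; rewrite subr_eq0 => /eqP E.
  have lte : (e + e < l + l)%N by clear -ltel; lia.
  move/qpoch_neq0P/(_ (e + e).+1 lte): Hal.
  by rewrite exprS mulrA [al * q]mulrC -w2 exprD expr2 mulrACA -E mul1r subrr eqxx.
have acE : a = al * c by rewrite alE divfK.
have qk0 : q ^+ k != 0 by rewrite expf_neq0.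
have := well_poised_expansion al0 w2 c0 qk0 Hq Hal nw.
rewrite -acE -/s => E.
have Es : qpoch s q k * qpoch (q ^+ k * s) q l = qpoch s q l * qpoch (q ^+ l * s) q k.
  by rewrite [_ * s]mulrC [q ^+ l * s]mulrC -!qpochD addnC.
have nsk' : qpoch (q ^+ k * s) q l != 0.
  have : qpoch s q k * qpoch (q ^+ k * s) q l != 0 by rewrite Es mulf_neq0.
  by rewrite mulf_eq0 negb_or => /andP[].
have -> : (qpoch s q k)^-1 = qpoch (q ^+ k * s) q l / (qpoch s q l * qpoch (q ^+ l * s)
  q k).
  by rewrite -Es invfM mulrCA divff // mulr1.
have -> : qpoch (q ^+ k * s) q l = qpoch q q l * qpoch w q l *
   (qpoch (q ^+ k * s) q l / (qpoch q q l * qpoch w q l)).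
  by field; rewrite Hq nw.
rewrite -{}E !mulr_sumr mulr_suml mulr_sumr; apply: eq_bigr => i _.
have : (i <= l)%N by rewrite -ltnS.
move: (nat_of_ord i) => {}i leil.
have := wp_coefE leil; set X := _ / _; set Y := wp_coef i => E.
transitivity (qpoch w q l / qpoch s q l / qpoch (q ^+ l * s) q k * (X * Y) *
  (qpoch (q ^+ (l + (l - i)) * a) q k * qpoch (q ^+ i * c) q k)); last first.
  by rewrite /X !invfM; ring.
rewrite E.
have Ea : qpoch (q ^+ l * a) q k * qpoch (q ^+ k * (q ^+ l * a)) q (l - i)
   = qpoch (q ^+ l * a) q (l - i) * qpoch (q ^+ (l + (l - i)) * a) q k.
  rewrite [q ^+ k * _]mulrC -qpochD addnC qpochD; congr (_ * qpoch _ _ _).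
  by rewrite exprD mulrAC.
have Ec : qpoch c q k * qpoch (q ^+ k * c) q i = qpoch c q i * qpoch (q ^+ i * c) q k.
  by rewrite [_ * c]mulrC [q ^+ i * c]mulrC -!qpochD addnC.
transitivity (qpoch q q l * qpoch w q l / (qpoch s q l * qpoch (q ^+ l * s) q k) * w ^+ i
  * (qpoch (q ^+ l * a) q k * qpoch (q ^+ k * (q ^+ l * a)) q (l - i))
  * (qpoch c q k * qpoch (q ^+ k * c) q i)
  / (qpoch q q i * qpoch q q (l - i) * qpoch (al * q ^+ (l - i)) q (l - i)
       * qpoch (al * q ^+ (l - i + (l - i)).+1) q i)); first by ring.
by rewrite Ea Ec !invfM; ring.
Qed.

End Coefficients.

End ParameterExpansion.

(** * Integer powers of q and the nonvanishing of denominators *)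

Lemma exprz_diff (F : fieldType) (q : F) (z : int) (p r : nat) :
  q != 0 -> z = p%:Z - r%:Z -> q ^ z = q ^+ p / q ^+ r.
Proof. by move=> q0 ->; rewrite expfzDr // -exprnN. Qed.

Section IntegerPowers.
Variables (F : fieldType) (q a c : F) (l m n : nat).
Hypothesis q0 : q != 0.

Lemma exprz_mBn : q ^ (m%:Z - n%:Z) = (q ^+ n)^-1 / (q ^+ m)^-1.
Proof. by rewrite (@exprz_diff _ _ _ m n) // invrK mulrC. Qed.

Lemma exprz_mB2n : q ^ (m%:Z - 2 * n%:Z) = (q ^+ n)^-1 ^+ 2 / (q ^+ m)^-1.
Proof.
rewrite (@exprz_diff _ _ _ m (n + n)) //; last by lia.
by rewrite invrK exprD invfM expr2 mulrC.
Qed.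

Lemma exprz_jB2n1 j : q ^ (j%:Z - 2 * n%:Z - 1) = (q ^+ n)^-1 ^+ 2 * q ^+ j / q.
Proof.
rewrite (@exprz_diff _ _ _ j (n + n).+1) //; last by lia.
by rewrite exprS exprD; field; rewrite q0 expf_neq0.
Qed.

Lemma exprz_mBn_mul j k :
  q ^ ((m%:Z - n%:Z) * j%:Z + k%:Z) = q ^+ k * ((q ^+ n)^-1 / (q ^+ m)^-1) ^+ j.
Proof. by rewrite expfzDr // mulrC -exprz_exp exprz_mBn. Qed.

Lemma exprz_2lB2i i : (i <= l)%N ->
  q ^ (2 * l%:Z - 2 * i%:Z) * a / c = a / c * q ^+ (l - i + (l - i)).
Proof.
move=> leil; rewrite (@exprz_diff _ _ _ (l - i + (l - i)) 0) //; last by lia.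
by rewrite expr0 divr1 -mulrA mulrC.
Qed.

Lemma exprz_2lBi i : (i <= l)%N -> q ^ (2 * l%:Z - i%:Z) = q ^+ (l + (l - i)).
Proof.
move=> leil; rewrite (@exprz_diff _ _ _ (l + (l - i)) 0) //; last by lia.
by rewrite expr0 divr1.
Qed.

Lemma exprz_1D2lBiDj i j : (i <= l)%N ->
  q ^ (1 + 2 * l%:Z - i%:Z + j%:Z) * a = q * (q ^+ (l + (l - i)) * a * q ^+ j).
Proof.
move=> leil; rewrite (@exprz_diff _ _ _ (1 + (l + (l - i)) + j) 0) //; last by lia.
by rewrite expr0 divr1 exprD exprS; ring.
Qed.

Lemma exprn_1DiDj i j : q ^+ (1 + i + j) * c = q * (q ^+ i * c * q ^+ j).
Proof. by rewrite exprD exprS; ring. Qed.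

Lemma exprn_1D2lD2j i j : (i <= l)%N ->
  q ^+ (1 + 2 * l + 2 * j) * a * c
  = q * (q ^+ (l + (l - i)) * a * q ^+ j) * (q ^+ i * c * q ^+ j).
Proof.
move=> leil; have -> : (1 + 2 * l + 2 * j = 1 + (l + (l - i)) + i + j + j)%N by lia.
by rewrite !exprD expr1; ring.
Qed.

Lemma exprz_N2l : a != 0 -> c != 0 ->
  q ^ (- (2 * l%:Z)) * c / a = (q ^+ (l + l) * (a / c))^-1.
Proof.
move=> a0 c0; rewrite (@exprz_diff _ _ _ 0 (l + l)) //; last by lia.
by rewrite expr0; field; rewrite a0 c0 expf_neq0.
Qed.

Lemma exprz_1B2l : q ^ (1 - 2 * l%:Z) / a = q / (q ^+ (l + l) * a).
Proof.
rewrite (@exprz_diff _ _ _ 1 (l + l)) //; last by lia.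
by rewrite expr1 invfM mulrA.
Qed.

Lemma exprz_1Bl : a != 0 -> c != 0 ->
  q ^ (1 - l%:Z) * c / a = q / (q ^+ l * (a / c)).
Proof.
move=> a0 c0; rewrite (@exprz_diff _ _ _ 1 l) // expr1.
by field; rewrite a0 c0 expf_neq0.
Qed.

Lemma qpoch_reflect_neq0 x : x != 0 ->
  qpoch (q / (x * q ^+ l)) q l != 0 -> qpoch x q l != 0.
Proof.
move=> x0; have := qpoch_reflect x0 q0 (leqnn l).
rewrite subnn qpoch0 mulr1 => ->; rewrite mulf_eq0 negb_or.
by case/andP.
Qed.

(* 1 - q^t with 0 < t <= 2n divides, up to a unit, a factor of (q;q)_n if
   t <= n, of (q^(m-2n);q)_n if n < t <= 2n - m, and of (q^(j-2n-1);q)_j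
   with j = 2n + 1 - t otherwise. *)
Lemma qpoch_2n_neq0 : (m <= n)%N ->
  qpoch q q n != 0 -> qpoch (q ^ (m%:Z - 2 * n%:Z)) q n != 0 ->
  (forall j, (j <= m)%N -> qpoch (q ^ (j%:Z - 2 * n%:Z - 1)) q j != 0) ->
  qpoch q q (n + n) != 0.
Proof.
move=> lemn /qpoch_neq0P Hn /qpoch_neq0P Hmn Hj.
apply/qpoch_neq0P => e; case: (ltnP e n) => [lten _|lene lte]; first exact: Hn.
have Hneg : 1 - (q ^+ e.+1)^-1 != 0 -> 1 - q * q ^+ e != 0.
  apply: contraNneq => /eqP; rewrite subr_eq0 => /eqP; rewrite exprS => <-.
  by rewrite invr1 subrr.
apply: Hneg; case: (leqP e.+1 (n + n - m)) => He.
  have ltk : (n + n - m - e.+1 < n)%N by clear -lemn lene lte; lia.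
  have := Hmn _ ltk; congr (1 - _ != 0).
  rewrite exprnP -expfzDr // exprnN; congr (q ^ _).
  by clear -lemn He; lia.
have lej : (n + n - e <= m)%N by clear -He; lia.
have /qpoch_neq0P/(_ 0%N) := Hj _ lej.
rewrite subn_gt0 => /(_ lte); rewrite expr0 mulr1 exprnN; congr (1 - q ^ _ != 0).
by clear -lte; lia.
Qed.

End IntegerPowers.

(** * Combination of the two expansions, and the theorem *)

Lemma phi43_expansion (F : fieldType) (q a c rq ra rc : F) (l m n : nat)
    (s := rq * ra * rc) (al := a / c) (w := rq * ra / rc)
    (u := (q ^+ n)^-1) (v := (q ^+ m)^-1) (S := q ^+ l * s) :
  q != 0 -> a != 0 -> c != 0 -> rq ^+ 2 = q -> ra ^+ 2 = a -> rc ^+ 2 = c ->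
  (m <= n)%N -> qpoch q q (n + n) != 0 -> qpoch q q l != 0 ->
  qpoch (q ^+ l * a) q l != 0 -> qpoch al q (l + l).+1 != 0 ->
  qpoch s q l != 0 -> qpoch s q n != 0 -> qpoch (S ^+ 2) (q ^+ 2) n != 0 ->
  phi43 n (q ^+ l * a) c u (- (u / v)) s (- S) (u ^+ 2 / v) q q
  = qpoch (q ^+ l * a) q l * qpoch w q l / (qpoch (al * q ^+ l) q l * qpoch s q l)
    * \sum_(i < l.+1) \sum_(j < m.+1)
        (let A := q ^+ (l + (l - i)) * a in let C := q ^+ i * c in
         wp_coef q rq ra rc a c al l i
         * (qpoch A q j * qpoch C q j / (qpoch S q j * qpoch (- S) q j)
            * sh_coef q u v j
            * (qpoch (q * (A * q ^+ j)) (q ^+ 2) (n - j)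
               * qpoch (q * (C * q ^+ j)) (q ^+ 2) (n - j)
               / (qpoch q (q ^+ 2) (n - j)
                  * qpoch (q * (A * q ^+ j) * (C * q ^+ j)) (q ^+ 2) (n - j))))).
Proof.
move=> q0 a0 c0 rqE raE rcE lemn Hq Hql Ha Hal nsl nsn HS.
have ra0 : ra != 0 by rewrite -sqrf_eq0 raE.
have rc0 : rc != 0 by rewrite -sqrf_eq0 rcE.
have qe k : q ^+ k != 0 by rewrite expf_neq0.
have swc : w * c = s by rewrite /s /w -rcE; field.
have nS k : (k <= n)%N -> qpoch S q k != 0.
  move=> /(qpoch_neq0_leq HS); rewrite -qpoch_sqr mulf_eq0 negb_or.
  by case/andP.
rewrite /phi43.
have Hexp k : (k <= n)%N -> _ := fun lekn => @parameter_expansion F q q0 rq ra rc a c al w l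
  rqE raE rcE c0 ra0 rc0 erefl erefl Hql Ha Hal k.
transitivity (\sum_(k < n.+1) (qpoch (q ^+ l * a) q k * qpoch c q k / qpoch s q k)
    * ((qpoch (- S) q k)^-1 * (qpoch u q k * qpoch (- (u / v)) q k
        / (qpoch q q k * qpoch (u ^+ 2 / v) q k) * q ^+ k))).
  apply: eq_bigr => k _; rewrite /qpochs !big_cons !big_nil !mulr1 !invfM.
  by ring.
transitivity (\sum_(k < n.+1)
    qpoch (q ^+ l * a) q l * qpoch w q l / (qpoch (al * q ^+ l) q l * qpoch s q l)
    * \sum_(i < l.+1) wp_coef q rq ra rc a c al l i *
        (qpoch (q ^+ (l + (l - i)) * a) q k * qpoch (q ^+ i * c) q k
         / (qpoch S q k * qpoch (- S) q k) * (qpoch u q k * qpoch (- (u / v)) q k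
        / (qpoch q q k * qpoch (u ^+ 2 / v) q k) * q ^+ k))).
  apply: eq_bigr => k _; have lekn : (k <= n)%N by rewrite -ltnS.
  have := Hexp k lekn; rewrite swc => -> //; last 2 first.
  - exact: qpoch_neq0_leq nsn lekn.
  - exact: nS.
  rewrite -mulrA; congr (_ * _); rewrite mulr_suml; apply: eq_bigr => i _.
  by rewrite -/S !invfM; ring.
rewrite -mulr_sumr exchange_big; congr (_ * _); apply: eq_bigr => i _ /=.
rewrite -mulr_sumr -[RHS]mulr_sumr; congr (_ * _).
have leil : (i <= l)%N by rewrite -ltnS.
(* With A = q^(2l-i) a and C = q^i c, the product qAC = S^2 is the same for all i; hence one pair S,
   -S of lower parameters serves every inner sum. *)
apply: shifted_jain_sum => //; rewrite ?mulVf //.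
have -> : q ^+ (l + (l - i)) = q ^+ l * q ^+ (l - i) by rewrite exprD.
have E : q ^+ l = q ^+ (l - i) * q ^+ i by rewrite -exprD subnK.
by rewrite /S /s !exprMn rqE raE rcE expr2 {2}E; ring.
Qed.

Unset Implicit Arguments.

(* rq, ra, rc are the fixed square roots of q, a, c. The hypotheses after
   m <= n say that each denominator occurring in the identity is nonzero. *)
Theorem mainTheorem2 (R : realType) (q a c rq ra rc : R[i]) (l m n : nat)
  (q_neq0 : q != 0) (a_neq0 : a != 0) (c_neq0 : c != 0)
  (rqE : rq ^+ 2 = q) (raE : ra ^+ 2 = a) (rcE : rc ^+ 2 = c)
  (le_mn : (m <= n)%N)
  (lhs_den : forall k : nat, (k <= n)%N ->
     qpochs [:: q; rq * ra * rc; - q ^+ l * (rq * ra * rc);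
                q ^ (m%:Z - 2 * n%:Z)] q k != 0)
  (pre_den : qpochs [:: q ^+ l * a / c; rq * ra * rc] q l != 0)
  (wp_den : 1 - q ^+ (2 * l) * a / c != 0)
  (i_den : forall i : nat, (i <= l)%N ->
     qpochs [:: q; q ^ (1 - 2 * l%:Z) / a; q ^ (1 - l%:Z) * c / a] q i != 0)
  (j_den : forall j : nat, (j <= m)%N ->
     qpochs [:: q; q ^+ l * (rq * ra * rc); - q ^+ l * (rq * ra * rc);
                q ^ (m%:Z - 2 * n%:Z); q ^ (j%:Z - 2 * n%:Z - 1)] q j != 0)
  (j_den2 : forall j : nat, (j <= m)%N ->
     qpochs [:: q; q ^+ (1 + 2 * l + 2 * j) * a * c] (q ^+ 2) (n - j) != 0) :
  phi43 n (q ^+ l * a) c (q ^ (- n%:Z)) (- q ^ (m%:Z - n%:Z))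
          (rq * ra * rc) (- q ^+ l * (rq * ra * rc)) (q ^ (m%:Z - 2 * n%:Z))
          q q
  = qpochs [:: q ^+ l * a; rq * ra / rc] q l
    / qpochs [:: q ^+ l * a / c; rq * ra * rc] q l
    * \sum_(i < l.+1) \sum_(j < m.+1)
        rq ^+ (5 * i)
        * q ^ ((m%:Z - n%:Z) * j%:Z + 'C(j.+1, 2)%:Z)
        * (1 / (ra * rc) ^+ i)
        * ((1 - q ^ (2 * l%:Z - 2 * i%:Z) * a / c)
           / (1 - q ^+ (2 * l) * a / c))
        * (qpochs [:: q ^ (- l%:Z); c; q ^ (- (2 * l%:Z)) * c / a] q i
           / qpochs [:: q; q ^ (1 - 2 * l%:Z) / a;
                        q ^ (1 - l%:Z) * c / a] q i)
        * (qpochs [:: q ^ (- m%:Z); q ^ (- n%:Z); - q ^ (- n%:Z);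
                      q ^ (2 * l%:Z - i%:Z) * a; q ^+ i * c] q j
           / qpochs [:: q; q ^+ l * (rq * ra * rc);
                        - q ^+ l * (rq * ra * rc); q ^ (m%:Z - 2 * n%:Z);
                        q ^ (j%:Z - 2 * n%:Z - 1)] q j)
        * (qpochs [:: q ^ (1 + 2 * l%:Z - i%:Z + j%:Z) * a;
                      q ^+ (1 + i + j) * c] (q ^+ 2) (n - j)
           / qpochs [:: q; q ^+ (1 + 2 * l + 2 * j) * a * c]
                    (q ^+ 2) (n - j)).
Proof.
pose s := rq * ra * rc; pose al := a / c.
have al0 : al != 0 by rewrite mulf_neq0 ?invr_neq0.
have qla0 : q ^+ l * a != 0 by rewrite mulf_neq0 ?expf_neq0.
have qlE k : q ^+ k * a / c = al * q ^+ k by rewrite /al -mulrA mulrC.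
(* These instances give the longest products of their families. *)
have Hk := lhs_den n (leqnn n); have Hi := i_den l (leqnn l).
have Hj := j_den2 0%N (leq0n m); have Hp := pre_den.
rewrite /qpochs !big_cons big_nil mulr1 !mulf_eq0 !negb_or in Hk.
rewrite /qpochs !big_cons big_nil mulr1 !mulf_eq0 !negb_or in Hi.
rewrite /qpochs !big_cons big_nil mulr1 !mulf_eq0 !negb_or in Hj.
rewrite /qpochs !big_cons big_nil mulr1 !mulf_eq0 !negb_or in Hp.
case/and4P: Hk => Hqn nsn _ Hmn; case/andP: Hp => Hpre nsl.
case/and3P: Hi => Hql Ha Hal.
(* Reflection converts (q^(1-2l)/a)_l and (q^(1-l) c/a)_l into (q^l a)_l and (a/c)_l. *)
rewrite exprz_1B2l // exprD -mulrA [q ^+ l * _]mulrC in Ha.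
have {}Ha := qpoch_reflect_neq0 q_neq0 qla0 Ha.
rewrite exprz_1Bl // -/al [q ^+ l * _]mulrC in Hal.
have {}Hal := qpoch_reflect_neq0 q_neq0 al0 Hal.
have Hq2n : qpoch q q (n + n) != 0.
  apply: (qpoch_2n_neq0 (m := m)) => // j lejm; have := j_den j lejm.
  by rewrite /qpochs !big_cons big_nil mulr1 !mulf_eq0 !negb_or => /and5P[].
(* The factors of (a/c)_(2l+1) come from three sources: (a/c)_l from [i_den], (q^l a/c)_l from
   [pre_den], and the last one from [wp_den]. *)
have Hal2 : qpoch al q (l + l).+1 != 0.
  by rewrite qpochSr qpochD -!qlE !mulf_neq0 // addnn -mul2n.
(* At j = 0, the second product in [j_den2] has argument q^(1+2l) a c = (q^l s)^2. *)
have HS : qpoch ((q ^+ l * s) ^+ 2) (q ^+ 2) n != 0.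
  case/andP: Hj => _; rewrite subn0 muln0 addn0.
  suff -> : q ^+ (1 + 2 * l) * a * c = (q ^+ l * s) ^+ 2 by [].
  by rewrite /s !exprMn rqE raE rcE -exprM mulnC exprD expr1; ring.
have := @phi43_expansion _ q a c rq ra rc l m n q_neq0 a_neq0 c_neq0 rqE raE rcE le_mn
  Hq2n Hql Ha Hal2 nsl nsn HS.
rewrite exprz_mBn // exprz_mB2n // -(exprnN q n) mulNr => ->.
rewrite -/s -/al; congr (_ * _).
  by rewrite /qpochs !big_cons !big_nil !mulr1 qlE.
apply: eq_bigr => i _; apply: eq_bigr => j _ /=.
have : (i <= l)%N by rewrite -ltnS.
move: (nat_of_ord i) (nat_of_ord j) => {}i {}j leil.
rewrite exprz_jB2n1 // exprz_mBn_mul // exprz_2lB2i // exprz_2lBi // exprz_1D2lBiDj //.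
rewrite -(exprnN q l) -(exprnN q m) exprn_1DiDj (exprn_1D2lD2j _ _ _ _ leil) ?exprz_N2l
  // exprz_1B2l // exprz_1Bl //.
rewrite /qpochs !big_cons !big_nil !mulr1 -/al qlE mul2n -addnn /wp_coef /sh_coef.
rewrite !invfM; ring.
Qed.
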